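(* Let $\{X_i: i\in I\}$ be an arbitrary family of Banach spaces and $\kappa$ a cardinal. (1) If $\big(\bigoplus_{i\in I}X_i\big)_{\ell_\infty}$ has the $\kappa$-Daugavet property, then $X_i$ has the $\kappa$-Daugavet property for every $i\in I$. (2) If $\big(\bigoplus_{i\in I}X_i\big)_{\ell_\infty}$ has the $\kappa$-perfect Daugavet property, then $X_i$ has the $\kappa$-perfect Daugavet property for every $i\in I$. In other words, $\mathfrak{Dau}\big(\big(\bigoplus_{i\in I}X_i\big)_{\ell_\infty}\big)\leq\min_{i\in I}\mathfrak{Dau}(X_i)$ and $\mathfrak{pDau}\big(\big(\bigoplus_{i\in I}X_i\big)_{\ell_\infty}\big)\leq\min_{i\in I}\mathfrak{pDau}(X_i)$.
   Context: All Banach spaces are real; $\big(\bigoplus_{i\in I}X_i\big)_{\ell_\infty}$ denotes the $\ell_\infty$-sum. $B_X$ and $S_X$ denote the closed unit ball and unit sphere of a Banach space $X$. A slice of $B_X$ is a nonempty intersection of $B_X$ with an open half-space, i.e. a set $\{x\in B_X: f(x)>\sup f(B_X)-\alpha\}$ with $f\in X^*$, $\alpha>0$. For a cardinal $\kappa$ (finite or infinite), $\{y_\alpha:\alpha<\kappa\}$ denotes a set of cardinality at most $\kappa$. $X$ has the $\kappa$-Daugavet property if for every family $\{y_\alpha:\alpha<\kappa\}\subseteq S_X$, every slice $S$ of $B_X$ and every $\varepsilon>0$ there is $x\in S$ with $\|y_\alpha+x\|>2-\varepsilon$ for all $\alpha<\kappa$. $X$ has the $\kappa$-perfect Daugavet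 property if for every family $\{y_\alpha:\alpha<\kappa\}\subseteq S_X$ and every slice $S$ of $B_X$ there is $x\in S$ with $\|y_\alpha+x\|=2$ for all $\alpha<\kappa$. For nonzero $X$, $\mathfrak{Dau}(X)$ (resp. $\mathfrak{pDau}(X)$) is the least cardinal $\kappa$ such that $X$ fails the $\kappa$-Daugavet (resp. $\kappa$-perfect Daugavet) property. *)

(* Defs.v *)
From HB Require Import structures.
From mathcomp Require Import all_boot all_order all_algebra.
From mathcomp Require Import boolp classical_sets functions cardinality reals.
From mathcomp Require Import topology normedtype.

Set Implicit Arguments.
Unset Strict Implicit.
Unset Printing Implicit Defensive.

Import Order.TTheory GRing.Theory Num.Theory.
Import numFieldNormedType.Exports.

Local Open Scope classical_set_scope.
Local Open Scope card_scope.
Local Open Scope ring_scope.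

Section linf_sum.
Context {R : realType} {I : Type} (X : I -> completeNormedModType R).

Record linf_sum := LinfSum {
  linf_val :> forall i, X i;
  linf_bounded : has_ubound (range (fun i => `|linf_val i|)) }.

Lemma linf_ext (x y : linf_sum) : (forall i, x i = y i) -> x = y.
Proof.
case: x y => [x bx] [y byy] /= xy.
have {}xy : x = y by exact: functional_extensionality_dep.
by rewrite xy in bx *; rewrite (Prop_irrelevance bx byy).
Qed.

HB.instance Definition _ := gen_eqMixin linf_sum.
HB.instance Definition _ := gen_choiceMixin linf_sum.

Let bounded0 : has_ubound (range (fun i => `|0 : X i|)).
Proof. by exists 0 => _ [i _ <-]; rewrite normr0. Qed.

Let boundedN (x : linf_sum) : has_ubound (range (fun i => `|- x i|)).
Proof.
have [M xM] := linf_bounded x.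
by exists M => _ [i _ <-]; rewrite normrN; apply: xM; exists i.
Qed.

Let boundedD (x y : linf_sum) : has_ubound (range (fun i => `|x i + y i|)).
Proof.
have [M xM] := linf_bounded x; have [N yN] := linf_bounded y.
exists (M + N) => _ [i _ <-]; rewrite (le_trans (ler_normD _ _))// lerD//.
  by apply: xM; exists i.
by apply: yN; exists i.
Qed.

Let boundedZ (a : R) (x : linf_sum) : has_ubound (range (fun i => `|a *: x i|)).
Proof.
have [M xM] := linf_bounded x.
exists (`|a| * M) => _ [i _ <-]; rewrite normrZ ler_wpM2l//.
by apply: xM; exists i.
Qed.

Definition linf_zero := LinfSum bounded0.
Definition linf_opp (x : linf_sum) := LinfSum (boundedN x).
Definition linf_add (x y : linf_sum) := LinfSum (boundedD x y).
Definition linf_scale (a : R) (x : linf_sum) := LinfSum (boundedZ a x).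

Let addA : associative linf_add.
Proof. by move=> x y z; apply: linf_ext => i /=; rewrite addrA. Qed.
Let addC : commutative linf_add.
Proof. by move=> x y; apply: linf_ext => i /=; rewrite addrC. Qed.
Let add0 : left_id linf_zero linf_add.
Proof. by move=> x; apply: linf_ext => i /=; rewrite add0r. Qed.
Let addN : left_inverse linf_zero linf_opp linf_add.
Proof. by move=> x; apply: linf_ext => i /=; rewrite addNr. Qed.

HB.instance Definition _ := GRing.isZmodule.Build linf_sum addA addC add0 addN.

Let scaleA a b x : linf_scale a (linf_scale b x) = linf_scale (a * b) x.
Proof. by apply: linf_ext => i /=; rewrite scalerA. Qed.
Let scale1 : left_id 1 linf_scale.
Proof. by move=> x; apply: linf_ext => i /=; rewrite scale1r. Qed.
Let scaleDr : right_distributive linf_scale +%R.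
Proof. by move=> a x y; apply: linf_ext => i /=; rewrite scalerDr. Qed.
Let scaleDl x : {morph linf_scale^~ x : a b / a + b}.
Proof. by move=> a b; apply: linf_ext => i /=; rewrite scalerDl. Qed.

HB.instance Definition _ :=
  GRing.Zmodule_isLmodule.Build R linf_sum scaleA scale1 scaleDr scaleDl.

(* If [I] is empty then the only element is [0], and [sup set0 = 0] *)
Definition linf_norm (x : linf_sum) : R := sup (range (fun i => `|x i|)).

Lemma le_linf_norm (x : linf_sum) i : `|x i| <= linf_norm x.
Proof. by apply: ub_le_sup; [exact: linf_bounded|exists i]. Qed.

Lemma linf_norm_le (x : linf_sum) M :
  0 <= M -> (forall i, `|x i| <= M) -> linf_norm x <= M.
Proof.
move=> M0 xM; rewrite /linf_norm.
have [[i]|I0] := pselect (exists i : I, True).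
  by move=> _; apply: ge_sup => [|_ [j _ <-]//]; exists `|x i|, i.
rewrite (_ : [set: I] = set0) ?image_set0 ?sup0//.
by rewrite -subset0 => i _; apply: I0; exists i.
Qed.

Lemma linf_norm_ge0 (x : linf_sum) : 0 <= linf_norm x.
Proof.
have [[i _]|I0] := pselect (exists i : I, True).
  exact: le_trans (le_linf_norm x i).
rewrite /linf_norm (_ : [set: I] = set0) ?image_set0 ?sup0//.
by rewrite -subset0 => i _; apply: I0; exists i.
Qed.

Let normD (x y : linf_sum) : linf_norm (x + y) <= linf_norm x + linf_norm y.
Proof.
apply: linf_norm_le => [|i]; first by rewrite addr_ge0// linf_norm_ge0.
by rewrite (le_trans (ler_normD _ _))// lerD// le_linf_norm.
Qed.

Let normZle (a : R) (x : linf_sum) : linf_norm (a *: x) <= `|a| * linf_norm x.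
Proof.
apply: linf_norm_le => [|i]; first by rewrite mulr_ge0// linf_norm_ge0.
by rewrite normrZ ler_wpM2l// le_linf_norm.
Qed.

Let normZ (a : R) (x : linf_sum) : linf_norm (a *: x) = `|a| * linf_norm x.
Proof.
apply/eqP; rewrite eq_le normZle/=; have [->|a0] := eqVneq a 0.
  by rewrite normr0 mul0r linf_norm_ge0.
rewrite -ler_pdivlMl ?normr_gt0// -normfV.
by rewrite -[X in linf_norm X <= _](scalerK a0) normZle.
Qed.

Let norm0_eq0 (x : linf_sum) : linf_norm x = 0 -> x = 0.
Proof.
move=> x0; apply: linf_ext => i; apply/normr0_eq0/eqP.
by rewrite eq_le normr_ge0 andbT -x0 le_linf_norm.
Qed.

HB.instance Definition _ :=
  Lmodule_isNormed.Build R linf_sum normD normZ norm0_eq0.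

Lemma linf_normE (x : linf_sum) : `|x| = sup (range (fun i => `|x i|)).
Proof. by []. Qed.

Let linf_complete (F : set_system linf_sum) :
  ProperFilter F -> cauchy F -> cvg F.
Proof.
move=> FF /cauchy_ballP Fc.
have {}Fc e : 0 < e -> exists2 A, F A &
    forall x y, A x -> A y -> forall i, `|x i - y i| <= e.
  move=> e0; have [[A B] [/= FA FB] AB] := Fc _ e0.
  exists (A `&` B) => [|x y [Ax _] [_ By] i]; first exact: filterI.
  have := AB (x, y) (conj Ax By); rewrite -ball_normE/= => /ltW.
  exact: le_trans (le_linf_norm (x - y) i).
pose Fi i := (fun x : linf_sum => x i) @ F.
have Fi_cvg i : cvg (Fi i).
  apply: cauchy_cvg; apply/cauchy_ballP => e e0.
  have [A FA Ae] := Fc (e / 2) (divr_gt0 e0 (ltr0Sn _ _)).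
  pose B := [set x i | x in A].
  exists (B, B) => [|[_ _] [/= [x Ax <-] [y Ay <-]]].
    by split; rewrite /Fi /nbhs/=; apply: filterS FA => x Ax; exists x.
  rewrite -ball_normE/= (le_lt_trans (Ae _ _ Ax Ay i))//.
  by rewrite ltr_pdivrMr// ltr_pMr// ltr1n.
pose l i : X i := lim (Fi i).
have Fl A e : F A -> (forall x y, A x -> A y -> forall i, `|x i - y i| <= e) ->
    forall x, A x -> forall i, `|x i - l i| <= e.
  move=> FA Ae x Ax i; rewrite leNgt; apply/negP => e_lt.
  have d0 : 0 < `|x i - l i| - e by rewrite subr_gt0.
  have /cvgr_dist_lt/(_ _ d0) Fd := Fi_cvg i.
  have [y [Ay /= ly]] := filter_ex (filterI FA Fd).
  have := le_lt_trans (ler_distD (y i) (x i) (l i)) (ler_ltD (Ae _ _ Ax Ay i) _).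
  by move=> /(_ (`|x i - l i| - e)); rewrite distrC subrKC ltxx => /(_ ly).
have bl : has_ubound (range (fun i => `|l i|)).
  have [A FA A1] := Fc 1 ltr01; have [x Ax] := filter_ex FA.
  exists (1 + linf_norm x) => _ [i _ <-].
  rewrite -(subrK (x i) (l i)) (le_trans (ler_normD _ _))// lerD ?le_linf_norm//.
  by rewrite distrC; exact: Fl FA A1 _ Ax i.
apply/cvg_ex; exists (LinfSum bl); apply/cvgrPdist_le => e e0.
have [A FA Ae] := Fc e e0; apply: (filterS _ FA) => x Ax.
apply: (linf_norm_le (ltW e0)) => i /=.
by rewrite distrC; exact: Fl FA Ae _ Ax i.
Qed.

HB.instance Definition _ := Uniform_isComplete.Build linf_sum linf_complete.

End linf_sum.

Section daugavet.
Context {R : realType}.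
Implicit Types X : completeNormedModType R.

Definition unit_ball X : set X := [set x | `|x| <= 1].

Definition unit_sphere X : set X := [set x | `|x| = 1].

Definition is_slice X (S : set X) : Prop :=
  exists (f : {linear X -> R^o}) (a : R), [/\ continuous f, 0 < a &
    S = [set x | unit_ball x /\ sup (f @` @unit_ball X) - a < f x]].

(* A cardinal is given by a type [K] of that cardinality *)
Definition daugavet (K : Type) X : Prop :=
  forall Y : set X, Y `<=` @unit_sphere X -> Y #<= [set: K] ->
  forall S : set X, is_slice S -> forall e : R, 0 < e ->
  exists2 x, S x & forall y, Y y -> 2 - e < `|y + x|.

Definition perfect_daugavet (K : Type) X : Prop :=
  forall Y : set X, Y `<=` @unit_sphere X -> Y #<= [set: K] ->
  forall S : set X, is_slice S ->
  exists2 x, S x & forall y, Y y -> `|y + x| = 2.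

Definition nonzero X : Prop := exists x : X, x != 0.

End daugavet.

Definition is_least_cardinal (P : Type -> Prop) (K : Type) : Prop :=
  P K /\ forall L : Type, P L -> [set: K] #<= [set: L].

Lemma card_family_min (J : Type) (L : J -> Type) (j0 : J) :
  exists j, forall k, [set: L j] #<= [set: L k].
Proof.
(* a maximal set of choice functions on which all projections are injective
   has a surjective projection *)
pose inj_proj (E : set (forall j, L j)) :=
  forall j f g, E f -> E g -> f j = g j -> f = g.
have [|E [Einj Emax]] := @Zorn_bigcup _ inj_proj.
  move=> F Finj Ftot j f g [A FA Af] [B FB Bg].
  have [AB|BA] := Ftot _ _ FA FB.
    by apply: Finj FB _ _ _ _ Bg; exact: AB.
  by apply: Finj FA _ _ _ Af _; exact: BA.
have [[j Ej]|nE] := pselect (exists j : J, forall x, exists2 f, E f & f j = x).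
  exists j => k.
  have [h hP] : {h : L j -> (forall i, L i) & forall x, E (h x) /\ h x j = x}.
    apply: (@choice _ _ (fun x f => E f /\ f j = x)) => x.
    by have [f] := Ej x; exists f.
  have hk_inj : injective (fun x => h x k).
    move=> x y hxy; have [[Ex hx] [Ey hy]] := (hP x, hP y).
    by rewrite -hx -hy (Einj k _ _ Ex Ey hxy).
  have /injfunPex[g] : exists2 g : L j -> L k,
      set_fun [set: L j] [set: L k] g & set_inj [set: L j] g.
    by exists (fun x => h x k) => // x y _ _ /hk_inj.
  exact: inj_card_le g.
have /all_sig[f fP] : forall j : J, {x | forall g, E g -> g j <> x}.
  move=> j; apply: cid; apply: contrapT => nx; apply: nE; exists j => x.
  apply: contrapT => ng; apply: nx; exists x => g Eg gx.
  by apply: ng; exists g.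
have nEf : ~ E f by move=> /(fP j0); exact.
exfalso; apply: (Emax (f |` E)).
  by split=> [g Eg|/(_ f (or_introl erefl))//]; right.
move=> j g1 g2 [->|E1] [->|E2]//.
- by move=> /esym/(fP j _ E2).
- by move=> /(fP j _ E1).
- exact: Einj E1 E2.
Qed.

Lemma card_le_total (K L : Type) :
  [set: K] #<= [set: L] \/ [set: L] #<= [set: K].
Proof.
by have [[] /= jP] := card_family_min (fun b : bool => if b then K else L) true;
  [left; exact: (jP false)|right; exact: (jP true)].
Qed.

Lemma least_cardinal_exists (P : Type -> Prop) :
  (exists K, P K) -> exists K, is_least_cardinal P K.
Proof.
move=> [K0 PK0].
pose J := {A : set K0 | exists2 L, P L & [set: L] #= A}.
have j0 : J by exists setT, K0.
have [[A [L PL LA]] /= Amin] :=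
  @card_family_min J (fun j => set_type (sval j)) j0.
have {}Amin (B : set K0) M : P M -> [set: M] #= B -> A #<= B.
  move=> PM MB; have := Amin (exist _ B (ex_intro2 _ _ M PM MB)).
  by rewrite /= (card_le_eql (card_setT A)) (card_le_eqr (card_setT B)).
exists L; split=> // M PM; rewrite (card_le_eql LA).
have [K0M|] := card_le_total K0 M.
  apply: card_le_trans K0M; exact: Amin PK0 (card_eqxx _).
move=> /card_leP[f].
pose g (x : M) : K0 := val (f (to_setT x)).
have g_inj : injective g.
  move=> x y /val_inj fxy.
  by have := inj (mem_set Logic.I) (mem_set Logic.I) fxy => /(congr1 val).
have gM : range g #= [set: M] by apply: inj_card_eq => x y _ _ /g_inj.
by rewrite -(card_le_eqr gM); apply: (Amin _ M PM); rewrite card_eq_sym.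
Qed.

(* The least cardinal satisfying [P], with a dummy value if there is none *)
Definition least_cardinal (P : Type -> Prop) : Type :=
  if pselect (exists K, is_least_cardinal P K) is left exK
  then projT1 (cid exK) else unit.

Lemma least_cardinalP (P : Type -> Prop) :
  (exists K, P K) -> is_least_cardinal P (least_cardinal P).
Proof.
move=> /least_cardinal_exists exK; rewrite /least_cardinal.
by case: pselect => // exK'; exact: projT2 (cid exK').
Qed.

(* The least element of the family of cardinals [L i], for [i] in [A] *)
Definition min_cardinal (I : Type) (A : set I) (L : I -> Type) : Type :=
  least_cardinal (fun K => exists2 i, A i & K = L i).

(* The zero space has the [K]-Daugavet property for all [K]: [Dau] and [pDau]
   are meaningful for nonzero spaces only, see [DauP] and [pDauP] below *)
Definition Dau {R : realType} (X : completeNormedModType R) : Type :=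
  least_cardinal (fun K => ~ daugavet K X).

Definition pDau {R : realType} (X : completeNormedModType R) : Type :=
  least_cardinal (fun K => ~ perfect_daugavet K X).

Section well_defined.
Context {R : realType} (X : completeNormedModType R) (X0 : nonzero X).

Let ball_slice : is_slice (@unit_ball R X).
Proof.
exists (\0%R : {linear X -> R^o}), 1; split => //.
  by move=> x; exact: cst_continuous.
apply/seteqP; split => x //=; last by case.
move=> x1; split=> //; rewrite (_ : _ @` _ = [set 0]) ?sup1 ?sub0r ?ltrN10//.
by apply/seteqP; split => [_ [y _ <-]//|_ ->]; exists x.
Qed.

Let antipode (x : X) : unit_ball x -> exists2 y, unit_sphere y & `|y + x| <= 1.
Proof.
move=> x1; have [->|x0] := eqVneq x 0.
  have [z z0] := X0; exists (`|z|^-1 *: z); rewrite ?addr0 /unit_sphere/=.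
    by rewrite normrZ normfV normr_id mulVf ?normr_eq0.
  by rewrite normrZ normfV normr_id mulVf ?normr_eq0.
exists (- (`|x|^-1 *: x)); rewrite /unit_sphere/=.
  by rewrite normrN normrZ normfV normr_id mulVf ?normr_eq0.
rewrite addrC -[X in `|X - _|]scale1r -scalerBl normrZ.
rewrite -{2}(normr_id x) -normrM mulrBl mul1r mulVf ?normr_eq0//.
by rewrite distrC ger0_norm ?subr_ge0// lerBlDr lerDl.
Qed.

Lemma DauP : is_least_cardinal (fun K => ~ daugavet K X) (Dau X).
Proof.
apply: least_cardinalP; exists (X : Type) => /(_ (@unit_sphere R X)).
move=> /(_ (@subset_refl _ _) (subset_card_le (@subsetT _ _)) _ ball_slice 1 ltr01)[x x1 xY].
have [y y1 yx] := antipode x1.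
by have := xY _ y1; rewrite ltNge -[2]/(1 + 1) addrK yx.
Qed.

Lemma pDauP : is_least_cardinal (fun K => ~ perfect_daugavet K X) (pDau X).
Proof.
apply: least_cardinalP; exists (X : Type) => /(_ (@unit_sphere R X)).
move=> /(_ (@subset_refl _ _) (subset_card_le (@subsetT _ _)) _ ball_slice)[x x1 xY].
have [y y1 yx] := antipode x1.
by move: yx; rewrite (xY _ y1) leNgt ltr1n.
Qed.

End well_defined.

(* Main.v *)
Require Import Defs.
From HB Require Import structures.
From mathcomp Require Import all_boot all_order all_algebra.
From mathcomp Require Import boolp classical_sets functions cardinality reals.
From mathcomp Require Import topology normedtype.

Import numFieldNormedType.Exports.
Import Order.TTheory GRing.Theory Num.Theory.

Local Open Scope classical_set_scope.
Local Open Scope card_scope.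
Local Open Scope ring_scope.

(** The canonical isometric copy of [X i] consists of vectors supported at [i].
Lift a family of unit vectors [y] along it, and pull the slice of the ball of
[X i] back along the [i]-th projection. If [z] is the point obtained for these
data in the sum, every coordinate of the lifted [y] plus [z] other than the
[i]-th one has norm at most 1, so a norm larger than 1 has to be attained at
the [i]-th coordinate: [z i] is the required point. *)

Section linf_coordinate.
Context {R : realType} {I : Type} {X : I -> completeNormedModType R}.
Context (i : I).

(** [I] is an arbitrary type; [{classic I}] gives it the decidable equality that [dfwith] needs. *)
Definition single (x : X i) : forall k, X k :=
  @dfwith {classic I} X (fun k => 0) i x.

Lemma single_in x : single x i = x.
Proof. exact: (@dfwith_in {classic I}). Qed.

Lemma single_out x k : k <> i -> single x k = 0.
Proof.
by move=> ki; apply: (@dfwith_out {classic I}); apply/eqP => /esym.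
Qed.

Lemma norm_single_le x k : `|single x k| <= `|x|.
Proof.
have [->|ki] := pselect (k = i); first by rewrite single_in.
by rewrite single_out// normr0.
Qed.

Lemma single_bounded x : has_ubound (range (fun k => `|single x k|)).
Proof. by exists `|x| => _ [k _ <-]; exact: norm_single_le. Qed.

Definition linf_single (x : X i) : linf_sum X := LinfSum (single_bounded x).

Lemma norm_linf_single x : `|linf_single x| = `|x|.
Proof.
apply/eqP; rewrite eq_le; apply/andP; split.
  by apply: linf_norm_le => // k; exact: norm_single_le.
by rewrite -{1}(single_in x); exact: (le_linf_norm (linf_single x)).
Qed.

Definition linf_proj (z : linf_sum X) : X i := z i.

Fact linf_proj_is_linear : linear linf_proj.
Proof. by []. Qed.

HB.instance Definition _ :=
  GRing.isLinear.Build R (linf_sum X) (X i) *:%R linf_proj linf_proj_is_linear.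

Lemma linf_proj_continuous : continuous linf_proj.
Proof.
move=> z; have Fz := nbhs_filter z; apply/cvgrPdist_le => e e0.
(* The projection is 1-Lipschitz, so the same [e] serves in the sum. *)
have /cvgrPdist_le/(_ e e0) := @cvg_id _ (nbhs z).
apply: filterS => w; exact: le_trans (le_linf_norm (z - w) i).
Qed.

(** Because the projection maps the ball onto the ball, [f] and [f \o linf_proj] have the same
    supremum, and a pulled-back slice keeps its width [a]. *)
Lemma linf_proj_ball : linf_proj @` @unit_ball R (linf_sum X) = @unit_ball R (X i).
Proof.
apply/seteqP; split=> [_ [z z1 <-]|x x1].
  exact: le_trans (le_linf_norm z i) z1.
exists (linf_single x); last exact: single_in.
by rewrite /unit_ball/= norm_linf_single.
Qed.

Lemma is_slice_linf_proj (S : set (X i)) : is_slice S ->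
  is_slice (@unit_ball R (linf_sum X) `&` linf_proj @^-1` S).
Proof.
move=> [f [a [fc a0 ->]]].
exists (f \o linf_proj : {linear linf_sum X -> R^o}), a; split => //.
  by move=> z; apply: continuous_comp; [exact: linf_proj_continuous|exact: fc].
rewrite -linf_proj_ball image_comp.
apply/seteqP; split=> [z [z1 [_ zf]]//|z [z1 zf]]; split=> //; split=> //.
Qed.

Lemma norm_linf_single_add_le x (z : linf_sum X) : unit_ball z ->
  `|linf_single x + z| <= Num.max `|x + z i| 1.
Proof.
move=> z1; apply: linf_norm_le => [|k]; first by rewrite le_max ler01 orbT.
rewrite /= le_max; have [->|ki] := pselect (k = i).
  by rewrite single_in lexx.
by rewrite single_out// add0r (le_trans (le_linf_norm z k) z1) orbT.
Qed.

Lemma linf_single_sphere (Y : set (X i)) :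
  Y `<=` @unit_sphere R (X i) ->
  linf_single @` Y `<=` @unit_sphere R (linf_sum X).
Proof.
by move=> Y1 _ [y /Y1 y1 <-]; rewrite /unit_sphere/= norm_linf_single.
Qed.

Lemma daugavet_coordinate (K : Type) :
  daugavet K (linf_sum X) -> daugavet K (X i).
Proof.
move=> D Y Y1 YK S /is_slice_linf_proj slS e e0.
(* Capping [e] at 1 gives [2 - Num.min e 1 >= 1], so the strict lower bound obtained in the sum
   cannot come from the entry 1 of the maximum. *)
have e10 : 0 < Num.min e 1 by rewrite lt_min e0 ltr01.
have [z [z1 Sz] zY] := D _ (linf_single_sphere Y Y1)
  (card_le_trans (card_image_le linf_single Y) YK) _ slS _ e10.
exists (z i) => // y Yy.
have := lt_le_trans (zY _ (imageP _ Yy)) (norm_linf_single_add_le y _ z1).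
rewrite lt_max => /orP[|]; last first.
  by rewrite ltNge lerBrDl -[2]/(1 + 1) lerD2r ge_min lexx orbT.
by apply: le_lt_trans; rewrite lerD2l lerN2 ge_min lexx.
Qed.

Lemma perfect_daugavet_coordinate (K : Type) :
  perfect_daugavet K (linf_sum X) -> perfect_daugavet K (X i).
Proof.
move=> D Y Y1 YK S /is_slice_linf_proj slS.
have [z [z1 Sz] zY] := D _ (linf_single_sphere Y Y1)
  (card_le_trans (card_image_le linf_single Y) YK) _ slS.
exists (z i) => // y Yy.
have := norm_linf_single_add_le y _ z1; rewrite (zY _ (imageP _ Yy)) le_max.
(* Since [2 <= 1] is false, the [i]-th coordinate has norm at least 2; the triangle inequality gives
   the reverse bound. *)
rewrite [X in _ || X]leNgt ltr1n orbF => le2; apply/eqP.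
rewrite eq_le le2 andbT (le_trans (ler_normD _ _))//.
by rewrite -[2]/(1 + 1) (Y1 _ Yy) lerD2l (le_trans (le_linf_norm z i) z1).
Qed.

Lemma nonzero_linf_sum : nonzero (X i) -> nonzero (linf_sum X).
Proof.
move=> [x x0]; exists (linf_single x).
by rewrite -normr_eq0 norm_linf_single normr_eq0.
Qed.

End linf_coordinate.

(** The minimum is attained: nonemptiness of [A] rules out the dummy value of [least_cardinal]. *)
Lemma min_cardinal_mem (I : Type) (A : set I) (L : I -> Type) :
  A !=set0 -> exists2 i, A i & min_cardinal A L = L i.
Proof.
move=> [i Ai].
have /least_cardinalP[] : exists K, exists2 i, A i & K = L i by exists (L i), i.
by [].
Qed.

(* Dau and pDau are defined for nonzero spaces: the minima are taken over the
   indices i with X i nonzero, i.e. over all of I if no X i is zero. *)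
Theorem proposition6p2 (R : realType) (I : Type)
    (X : I -> completeNormedModType R) :
  [/\ forall kappa : Type, daugavet kappa (linf_sum X) ->
        forall i, daugavet kappa (X i),
      forall kappa : Type, perfect_daugavet kappa (linf_sum X) ->
        forall i, perfect_daugavet kappa (X i)
    & (exists i, nonzero (X i)) ->
      [set: Dau (linf_sum X)] #<=
        [set: min_cardinal [set i | nonzero (X i)] (fun i => Dau (X i))]
      /\
      [set: pDau (linf_sum X)] #<=
        [set: min_cardinal [set i | nonzero (X i)] (fun i => pDau (X i))]].
Proof.
split=> [K D i|K D i|X0].
- exact: daugavet_coordinate D.
- exact: perfect_daugavet_coordinate D.
split.
- have [i Xi ->] := min_cardinal_mem _ _ (fun i => Dau (X i)) X0.
  (* By leastness it suffices that the sum fails the property for the cardinal [Dau (X i)], at which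
     [X i] itself fails. *)
  have [_] := DauP (nonzero_linf_sum _ Xi); apply.
  by have [nD _] := DauP Xi; move=> /(daugavet_coordinate i)/nD.
- have [i Xi ->] := min_cardinal_mem _ _ (fun i => pDau (X i)) X0.
  have [_] := pDauP (nonzero_linf_sum _ Xi); apply.
  by have [nD _] := pDauP Xi; move=> /(perfect_daugavet_coordinate i)/nD.
Qed.
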